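(* Let $\mathcal B^n_k(x)=\binom nk\left(\frac{1+x}2\right)^k\left(\frac{1-x}2\right)^{n-k}$, $0\le k\le n$. For $q\in(0,1)$ consider the equation $$\sigma_{n,k}(x)\,\mathbb D_x\mathcal B^n_k(x)=\tau_{n,k}(x)\,\mathbb S_x\mathcal B^n_k(x)\qquad(\ast)$$ in unknown polynomials $\sigma_{n,k},\tau_{n,k}$ in $x$ with $\deg\sigma_{n,k}\le2$ and $\deg\tau_{n,k}\le1$. For $n\le2$ and every $0\le k\le n$, equation $(\ast)$ has a nonzero solution $(\sigma_{n,k},\tau_{n,k})\ne(0,0)$. For $n=3$ and every $0\le k\le3$, equation $(\ast)$ admits only the trivial solution $\sigma_{3,k}=\tau_{3,k}=0$, for every $q\in(0,1)$. As $q\uparrow1$ (where $\mathbb D_x\to\frac{d}{dx}$ and $\mathbb S_x\to\mathrm{Id}$ on polynomials) the affine Bernstein ladder on $[-1,1]$, $$(1-x^2)\frac{d}{dx}\mathcal B^n_k(x)=(2k-n-nx)\,\mathcal B^n_k(x),$$ is recovered for every $n$ and $0\le k\le n$; under the change of variable $t=(1+x)/2$ it is equivalent to the classical identity $t(1-t)\frac{d}{dt}b^n_k(t)=(k-nt)\,b^n_k(t)$ on $[0,1]$, where $b^n_k(t)=\binom nk t^k(1-t)^{n-k}$.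
   Context: On the $q$-quadratic lattice $x=x(s)=\frac12(q^s+q^{-s})=\cos\theta$, with $z=q^s=e^{i\theta}$, the divided-difference and averaging operators act on a polynomial $f$ in $x$ by $$\mathbb D_xf=\frac{\breve f(q^{1/2}z)-\breve f(q^{-1/2}z)}{\breve e(q^{1/2}z)-\breve e(q^{-1/2}z)},\qquad \mathbb S_xf=\tfrac12\bigl[\breve f(q^{1/2}z)+\breve f(q^{-1/2}z)\bigr],$$ where $\breve f(z)=f\bigl(\frac12(z+z^{-1})\bigr)$ and $\breve e(z)=\frac12(z+z^{-1})$. Both $\mathbb D_xf$ and $\mathbb S_xf$ are polynomials in $x=\frac12(z+z^{-1})$. *)

(* Defs.v *)
From HB Require Import structures.
From mathcomp Require Import all_boot all_order all_algebra.
From mathcomp Require Import all_classical all_reals all_analysis.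
From mathcomp Require Import complex ring.

Set Implicit Arguments.
Unset Strict Implicit.
Unset Printing Implicit Defensive.

Import Order.TTheory GRing.Theory Num.Theory numFieldNormedType.Exports.
Local Open Scope ring_scope.
Local Open Scope classical_set_scope.
Local Open Scope complex_scope.

Definition bernstein01 (F : fieldType) (n k : nat) : {poly F} :=
  'C(n, k)%:R *: ('X ^+ k * (1 - 'X) ^+ (n - k)).

Definition bernstein (F : fieldType) (n k : nat) : {poly F} :=
  'C(n, k)%:R *: ((2^-1 *: (1 + 'X)) ^+ k * (2^-1 *: (1 - 'X)) ^+ (n - k)).

Definition ebreve (F : fieldType) (z : F) : F := (z + z^-1) / 2.

Definition breve (F : fieldType) (f : {poly F}) (z : F) : F := f.[ebreve z].

Definition qhalf (R : realType) (q : R) : R[i] := (Num.sqrt q)%:C.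

(* [is_Dx q f g]: the divided difference of f, a function of z, is the
   polynomial g in x = (z + 1/z)/2.  For 0 < q < 1 the excluded points
   are z = 0, 1, -1. *)
Definition is_Dx (R : realType) (q : R) (f g : {poly R[i]}) : Prop :=
  forall z : R[i], z != 0 ->
    ebreve (qhalf q * z) - ebreve ((qhalf q)^-1 * z) != 0 ->
    g.[ebreve z] =
      (breve f (qhalf q * z) - breve f ((qhalf q)^-1 * z))
      / (ebreve (qhalf q * z) - ebreve ((qhalf q)^-1 * z)).

Definition is_Sx (R : realType) (q : R) (f g : {poly R[i]}) : Prop :=
  forall z : R[i], z != 0 ->
    g.[ebreve z] =
      2^-1 * (breve f (qhalf q * z) + breve f ((qhalf q)^-1 * z)).

(* Well defined for 0 < q < 1 by [DxP], [is_Dx_inj], [SxP], [is_Sx_inj]. *)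
Definition Dx (R : realType) (q : R) (f : {poly R[i]}) : {poly R[i]} :=
  xget 0 [set g | is_Dx q f g].

Definition Sx (R : realType) (q : R) (f : {poly R[i]}) : {poly R[i]} :=
  xget 0 [set g | is_Sx q f g].

Definition q_ladder (R : realType) (q : R) (n k : nat)
    (sigma tau : {poly R[i]}) : Prop :=
  [/\ (size sigma <= 3)%N, (size tau <= 2)%N &
      sigma * Dx q (bernstein _ n k) = tau * Sx q (bernstein _ n k)].

(* Convergence in the space of polynomials: coefficientwise, with eventually
   bounded degree. *)
Definition poly_cvg (F : numFieldType) (T : Type) (G : set_system T)
    (P : T -> {poly F}) (L : {poly F}) : Prop :=
  (exists N : nat, \forall t \near G, (size (P t) <= N)%N) /\
  (forall i : nat, (P t)`_i @[t --> G] --> L`_i).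

Definition ladder_sigma (F : fieldType) : {poly F} := 1 - 'X ^+ 2.

Definition ladder_tau (F : fieldType) (n k : nat) : {poly F} :=
  (2 * k%:R - n%:R)%:P - n%:R *: 'X.

Definition affine_lhs (R : realType) (n k : nat) (x : R) : R :=
  (1 - x ^+ 2) * derive1 (fun y : R => (bernstein R n k).[y]) x.

Definition affine_rhs (R : realType) (n k : nat) (x : R) : R :=
  (2 * k%:R - n%:R - n%:R * x) * (bernstein R n k).[x].

Definition classical_lhs (R : realType) (n k : nat) (t : R) : R :=
  t * (1 - t) * derive1 (fun u : R => (bernstein01 R n k).[u]) t.

Definition classical_rhs (R : realType) (n k : nat) (t : R) : R :=
  (k%:R - n%:R * t) * (bernstein01 R n k).[t].

Lemma qhalf_neq0 (R : realType) (q : R) : 0 < q < 1 -> qhalf q != 0.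
Proof.
move=> /andP[q0 _]; rewrite /qhalf -[0]/(0%:C) (inj_eq (@complexI R)).
by rewrite sqrtr_eq0 -ltNge.
Qed.

Lemma qhalf_sqr (R : realType) (q : R) : 0 < q < 1 -> qhalf q ^+ 2 - 1 != 0.
Proof.
move=> /andP[q0 q1]; rewrite subr_eq0 /qhalf -rmorphXn /= sqr_sqrtr ?ltW//.
by rewrite -[1]/(1%:C) (inj_eq (@complexI R)) lt_eqF.
Qed.

Lemma DSx_exists (R : realType) (q : R) (f : {poly R[i]}) : 0 < q < 1 ->
  exists g h : {poly R[i]}, forall z : R[i], z != 0 ->
    breve f (qhalf q * z) - breve f ((qhalf q)^-1 * z) =
      g.[ebreve z] * (ebreve (qhalf q * z) - ebreve ((qhalf q)^-1 * z)) /\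
    h.[ebreve z] =
      2^-1 * (breve f (qhalf q * z) + breve f ((qhalf q)^-1 * z)).
Proof.
move=> q01; have p0 := qhalf_neq0 q01; set p := qhalf q in p0 *.
elim/poly_ind: f => [|f c [g [h IH]]].
  by exists 0, 0 => z z0; rewrite /breve !horner0 !(subrr, mul0r, addr0, mulr0).
pose a : R[i] := (p + p^-1) / 2.
exists (h + a *: ('X * g)).
exists (((a ^+ 2 - 1) *: (('X ^+ 2 - 1) * g)) + a *: ('X * h) + c%:P) => z z0.
have [IH1 IH2] := IH z z0.
rewrite /breve !(hornerD, hornerM, hornerZ, hornerN, hornerX, hornerC, hornerXn).
rewrite -/(breve f _) -/(breve f _) IH2.
set A := breve f _ in IH1 *; set B := breve f _ in IH1 *.
have -> : A = B + g.[ebreve z] * (ebreve (p * z) - ebreve (p^-1 * z)).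
  by rewrite -IH1 addrC subrK.
rewrite /a /ebreve; split; field; rewrite ?p0 ?z0 ?pnatr_eq0//.
Qed.

Lemma DxP (R : realType) (q : R) (f : {poly R[i]}) : 0 < q < 1 ->
  is_Dx q f (Dx q f).
Proof.
move=> /(DSx_exists f)[g [h H]]; apply: (@xgetPex _ 0 [set g | is_Dx q f g]).
by exists g => z z0 d0; have [-> _] := H z z0; rewrite mulfK.
Qed.

Lemma SxP (R : realType) (q : R) (f : {poly R[i]}) : 0 < q < 1 ->
  is_Sx q f (Sx q f).
Proof.
move=> /(DSx_exists f)[g [h H]]; apply: (@xgetPex _ 0 [set g | is_Sx q f g]).
by exists h => z z0; have [_ ->] := H z z0.
Qed.

Lemma ebreve_surj (R : realType) (x : R[i]) :
  exists2 z : R[i], z != 0 & ebreve z = x.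
Proof.
pose s := sqrtC (x ^+ 2 - 1).
have s2 : s ^+ 2 = x ^+ 2 - 1 by rewrite sqrtCK.
have zz : (x + s) * (x - s) = 1 by rewrite mulrC -subr_sqr s2 opprB addrC subrK.
have z0 : x + s != 0 by apply: contra_eq_neq zz => ->; rewrite mul0r eq_sym oner_neq0.
exists (x + s) => //; rewrite /ebreve.
have -> : (x + s)^-1 = x - s by rewrite -[LHS]mulr1 -zz mulKf.
by field; rewrite ?pnatr_eq0.
Qed.

Lemma poly_eq_horner (F : numFieldType) (f g : {poly F}) :
  (forall x, f.[x] = g.[x]) -> f = g.
Proof.
move=> fg; apply/eqP; rewrite -subr_eq0; apply/eqP.
apply: (@roots_geq_poly_eq0 _ _ [seq i%:R | i <- iota 0 (size (f - g))]).
- by apply/allP => x _; rewrite rootE hornerD hornerN fg subrr.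
- rewrite map_inj_uniq ?iota_uniq// => i j /eqP; rewrite eqr_nat.
  exact/eqP.
- by rewrite size_map size_iota.
Qed.

Lemma is_Sx_inj (R : realType) (q : R) (f g h : {poly R[i]}) :
  is_Sx q f g -> is_Sx q f h -> g = h.
Proof.
move=> Hg Hh; apply: poly_eq_horner => x.
by have [z z0 <-] := ebreve_surj x; rewrite Hg// Hh.
Qed.

Lemma is_Dx_inj (R : realType) (q : R) (f g h : {poly R[i]}) : 0 < q < 1 ->
  is_Dx q f g -> is_Dx q f h -> g = h.
Proof.
move=> q01 Hg Hh; have p0 := qhalf_neq0 q01; have p2 := qhalf_sqr q01.
have X0 : ('X ^+ 2 - 1 : {poly R[i]}) != 0.
  by apply: monic_neq0; apply: monicXnsubC.
apply: (mulIf X0); apply: poly_eq_horner => x.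
rewrite !(hornerM _ ('X ^+ 2 - 1)) !(hornerD, hornerN, hornerXn, hornerC).
have [z z0 xE] := ebreve_surj x.
have [->|x2] := eqVneq (x ^+ 2) 1; first by rewrite subrr !mulr0.
congr (_ * _); rewrite -xE Hg ?Hh//.
all: move: x2; rewrite -xE; apply: contra_neq.
all: set p := qhalf q in p0 p2 *.
all: have -> : ebreve (p * z) - ebreve (p^-1 * z) =
  (p ^+ 2 - 1) / p * ((z ^+ 2 - 1) / (2 * z))
  by rewrite /ebreve; field; rewrite ?p0 ?z0 ?pnatr_eq0.
all: move/eqP; rewrite !mulf_eq0 !invr_eq0 mulf_eq0 (negPf p0) (negPf p2).
all: rewrite (negPf z0) pnatr_eq0 /= orbF => /eqP/subr0_eq z2.
all: have zV : z^-1 = z by rewrite -[LHS]mul1r -z2 expr2 mulfK.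
all: rewrite /ebreve zV -{2}z2; field; rewrite ?pnatr_eq0//.
Qed.

(* Main.v *)
(** Write p = q^(1/2).  For n <= 2 the pair (S B, D B) satisfies the degree
    bounds and solves the equation.  For n >= 3, a common zero (z + 1/z)/2 of
    D B and S B would make B vanish at both lattice points pz and z/p; as the
    only zeros of B are 1 and -1, this gives (pz)^2 = (z/p)^2 = 1 and p^4 = 1,
    which is absurd.  So D B and S B are coprime, and S B, which has degree n,
    must divide sigma, of degree at most 2.  The limits q -> 1 follow by
    induction on the degree from the product rules for D (x f) and S (x f),
    whose coefficients are polynomials in (p + 1/p)/2 -> 1. *)

Require Import Defs.
From HB Require Import structures.
From mathcomp Require Import all_boot all_order all_algebra.
From mathcomp Require Import all_classical all_reals all_analysis.
From mathcomp Require Import complex.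
From mathcomp Require Import ring lra.

Set Implicit Arguments.
Unset Strict Implicit.
Unset Printing Implicit Defensive.

Import Order.TTheory GRing.Theory Num.Theory numFieldNormedType.Exports.
Local Open Scope ring_scope.
Local Open Scope classical_set_scope.
Local Open Scope complex_scope.

(** * Product rules for the two operators *)

(** Division-free form of [DxP], valid also at z = 1 and z = -1: the polynomial from [DSx_exists]
    satisfies it everywhere, and uniqueness identifies that polynomial with [Dx q f]. *)
Lemma breve_subE (R : realType) (q : R) (f : {poly R[i]}) (z : R[i]) :
  0 < q < 1 -> z != 0 ->
  breve f (qhalf q * z) - breve f ((qhalf q)^-1 * z) =
    (Dx q f).[ebreve z] * (ebreve (qhalf q * z) - ebreve ((qhalf q)^-1 * z)).
Proof.
move=> q01 z0; have [g [h H]] := DSx_exists f q01.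
suff -> : Dx q f = g by have [] := H z z0.
apply: (is_Dx_inj q01 (DxP f q01)) => w w0 d0.
by have [-> _] := H w w0; rewrite mulfK.
Qed.

Lemma breve_addE (R : realType) (q : R) (f : {poly R[i]}) (z : R[i]) :
  0 < q < 1 -> z != 0 ->
  breve f (qhalf q * z) + breve f ((qhalf q)^-1 * z) =
    2 * (Sx q f).[ebreve z].
Proof.
by move=> q01 z0; rewrite (SxP f q01 z0) mulrA divff ?mul1r ?pnatr_eq0.
Qed.

(** The constant alpha with S x = alpha x, where x is the variable; it tends to 1 with q. *)
Definition qalpha (R : realType) (q : R) : R[i] :=
  (qhalf q + (qhalf q)^-1) / 2.

Lemma Dx0 (R : realType) (q : R) : 0 < q < 1 -> Dx q (0 : {poly R[i]}) = 0.
Proof.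
move=> q01; apply: (is_Dx_inj q01 (DxP 0 q01)) => z z0 d0.
by rewrite /breve !horner0 subrr mul0r.
Qed.

Lemma Sx0 (R : realType) (q : R) : 0 < q < 1 -> Sx q (0 : {poly R[i]}) = 0.
Proof.
move=> q01; apply: (is_Sx_inj (SxP 0 q01)) => z z0.
by rewrite /breve !horner0 addr0 mulr0.
Qed.

Lemma breve_MXaddC (F : fieldType) (f : {poly F}) (c z : F) :
  breve (f * 'X + c%:P) z = breve f z * ebreve z + c.
Proof. by rewrite /breve !hornerE. Qed.

(** Instance of D(fg) = Sf Dg + Df Sg with g = x, where D x = 1 and S x = alpha x. *)
Lemma Dx_MXaddC (R : realType) (q : R) (f : {poly R[i]}) (c : R[i]) :
  0 < q < 1 ->
  Dx q (f * 'X + c%:P) = Sx q f + (qalpha q)%:P * ('X * Dx q f).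
Proof.
move=> q01; apply: (is_Dx_inj q01 (DxP _ q01)) => z z0 d0.
apply: (mulIf d0); rewrite divfK//.
have HD := breve_subE f q01 z0; have HS := SxP f q01 z0.
rewrite !(hornerD, hornerM, hornerN, hornerX, hornerC, hornerXn) HS.
rewrite !breve_MXaddC.
set A := breve f _ in HD *; set B := breve f _ in HD *.
have -> : A = B + (Dx q f).[ebreve z] *
    (ebreve (qhalf q * z) - ebreve ((qhalf q)^-1 * z)).
  by rewrite -HD addrC subrK.
rewrite /qalpha /ebreve; field.
by rewrite z0 qhalf_neq0 //= pnatr_eq0.
Qed.

(** With e1, e2 the values of x at pz and z/p, S(xf) = Sf (e1 + e2)/2 + Df (e1 - e2)^2/4, and (e1 -
    e2)^2/4 = (alpha^2 - 1)(x^2 - 1). *)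
Lemma Sx_MXaddC (R : realType) (q : R) (f : {poly R[i]}) (c : R[i]) :
  0 < q < 1 ->
  Sx q (f * 'X + c%:P) =
    (qalpha q ^+ 2 - 1)%:P * (('X ^+ 2 - 1) * Dx q f) +
    (qalpha q)%:P * ('X * Sx q f) + c%:P.
Proof.
move=> q01; apply: (is_Sx_inj (SxP _ q01)) => z z0.
have HD := breve_subE f q01 z0; have HS := SxP f q01 z0.
rewrite !(hornerD, hornerM, hornerN, hornerX, hornerC, hornerXn) HS.
rewrite !breve_MXaddC.
set A := breve f _ in HD *; set B := breve f _ in HD *.
have -> : A = B + (Dx q f).[ebreve z] *
    (ebreve (qhalf q * z) - ebreve ((qhalf q)^-1 * z)).
  by rewrite -HD addrC subrK.
rewrite /qalpha /ebreve; field.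
by rewrite z0 qhalf_neq0 //= pnatr_eq0.
Qed.

(** * Degrees and leading coefficients *)

(** The two bounds are proved together because each product rule involves both Df and Sf. *)
Lemma size_DSx (R : realType) (q : R) (f : {poly R[i]}) (n : nat) :
  0 < q < 1 -> (size f <= n.+1)%N ->
  (size (Dx q f) <= n)%N /\ (size (Sx q f) <= n.+1)%N.
Proof.
move=> q01; elim/poly_ind: f n => [|f c IH] n.
  by move=> _; rewrite Dx0// Sx0// size_poly0.
rewrite size_MXaddC; have [-> _|f0] := eqVneq f 0.
  rewrite Dx_MXaddC// Sx_MXaddC// Dx0// Sx0// !mulr0 !add0r size_poly0.
  by rewrite (leq_trans (size_polyC_leq1 _)).
rewrite /= ltnS; case: n => [|n fn].
  by rewrite leqn0 size_poly_eq0 (negPf f0).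
have [IHD IHS] := IH n fn.
have sM (p r : {poly R[i]}) (a b : nat) : (size p <= a.+1)%N ->
    (size r <= b)%N -> (size (p * r)%R <= a + b)%N.
  move=> pa rb; apply: leq_trans (size_polyMleq _ _) _.
  by rewrite -subn1 leq_subLR add1n -addSn leq_add.
have sC (a : R[i]) : (size a%:P <= 1)%N := size_polyC_leq1 a.
have s1 (p : {poly R[i]}) (a : nat) : (size p <= a)%N ->
    (size ('X * p)%R <= a.+1)%N.
  by move=> pa; apply: (@sM _ _ 1) => //; rewrite size_polyX.
rewrite Dx_MXaddC// Sx_MXaddC//; split.
  rewrite (leq_trans (size_polyD _ _))// geq_max IHS/=.
  by apply: (@sM _ _ 0%N) => //; exact: s1.
rewrite (leq_trans (size_polyD _ _))// geq_max (leq_trans (sC _))// andbT.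
rewrite (leq_trans (size_polyD _ _))// geq_max; apply/andP; split.
  apply: (@sM _ _ 0%N) => //; apply: (@sM _ _ 2) => //.
  by rewrite -[1]/(1%:P) size_XnsubC.
by apply: (@sM _ _ 0%N) => //; exact: s1.
Qed.

(* The factors come from the leading term z^n of the Laurent polynomial of
   x^n; the factor 'X avoids the index n - 1 when n = 0. *)
Lemma lead_DSx (R : realType) (q : R) (f : {poly R[i]}) (n : nat) :
  0 < q < 1 -> (size f <= n.+1)%N ->
  let p := qhalf q in
  ('X * Dx q f)`_n = f`_n * ((p ^+ n - p ^- n) / (p - p^-1)) /\
  (Sx q f)`_n = f`_n * ((p ^+ n + p ^- n) / 2).
Proof.
move=> q01 + p; have p0 : p != 0 := qhalf_neq0 q01.
have p2 : p ^+ 2 - 1 != 0 := qhalf_sqr q01.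
have pp : p - p^-1 != 0.
  apply: contra_neq p2 => /eqP; rewrite subr_eq0 => /eqP pV.
  by rewrite expr2 {2}pV divff ?subrr.
elim/poly_ind: f n => [|f c IH] n.
  by move=> _; rewrite Dx0// Sx0// mulr0 !coef0 !mul0r.
rewrite size_MXaddC; have [-> _|f0] := eqVneq f 0.
  rewrite Dx_MXaddC// Sx_MXaddC// Dx0// Sx0// !mulr0 !add0r !mulr0 !mul0r add0r.
  rewrite !coefC; case: n => [|n] /=; last by rewrite !mul0r.
  by rewrite expr0 invr1 subrr mul0r mulr0 divff ?mulr1// pnatr_eq0.
rewrite /= ltnS; case: n => [|n fn].
  by rewrite leqn0 size_poly_eq0 (negPf f0).
have [IHD IHS] := IH n fn; have [sD sS] := size_DSx q01 fn.
(* Since Df has size at most n, only the square in ['X ^+ 2 - 1] contributes at index n + 1. *)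
have D1 : (Dx q f)`_n.+1 = 0 by rewrite nth_default// (leq_trans sD).
have E : (('X ^+ 2 - 1) * Dx q f)`_n.+1 = ('X * Dx q f)`_n.
  by rewrite mulrBl mul1r coefB expr2 -mulrA D1 subr0 [LHS]coefXM.
have -> : (f * 'X + c%:P)`_n.+1 = f`_n by rewrite coefD coefMX coefC addr0.
rewrite coefXM Dx_MXaddC// Sx_MXaddC// !coefD !coefCM E.
rewrite (coefXM (Sx q f)) coefC /= IHS IHD /qalpha -/p !exprS addr0.
by split; field; rewrite ?p0 ?p2 ?expf_neq0 ?pnatr_eq0.
Qed.

(** Both terms are positive reals. Up to the factor 1/2, this is the multiplier of the leading
    coefficient under S. *)
Lemma qhalf_expn1D_neq0 (R : realType) (q : R) (n : nat) :
  0 < q < 1 -> qhalf q ^+ n + qhalf q ^- n != 0.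
Proof.
move=> /andP[q0 _]; have p0 : 0 < Num.sqrt q by rewrite sqrtr_gt0.
rewrite /qhalf -!rmorphXn -fmorphV -rmorphD /= -[0]/(0%:C).
rewrite (inj_eq (@complexI R)) gt_eqF// addr_gt0 ?invr_gt0 ?exprn_gt0//.
Qed.

Lemma size_Sx (R : realType) (q : R) (f : {poly R[i]}) :
  0 < q < 1 -> size (Sx q f) = size f.
Proof.
move=> q01; case E : (size f) => [|n].
  by move/eqP: E; rewrite size_poly_eq0 => /eqP->; rewrite Sx0// size_poly0.
have fn : (size f <= n.+1)%N by rewrite E.
apply/eqP; rewrite eqn_leq (size_DSx q01 fn).2 /= ltnNge.
apply/negP => /leq_sizeP/(_ n (leqnn n)).
have [_ ->] := lead_DSx q01 fn.
have -> : f`_n = lead_coef f by rewrite lead_coefE E.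
apply/eqP; rewrite !mulf_neq0 ?invr_eq0 ?pnatr_eq0 ?qhalf_expn1D_neq0//.
by rewrite lead_coef_eq0 -size_poly_eq0 E.
Qed.

(** * Bernstein polynomials and coprimality *)

Lemma size_bernstein (F : numFieldType) (n k : nat) :
  (k <= n)%N -> size (bernstein F n k) = n.+1.
Proof.
move=> kn; have p0 : (2 : F) != 0 by rewrite pnatr_eq0.
have hu : size (2^-1 *: (1 + 'X) : {poly F}) = 2.
  by rewrite size_scale ?invr_eq0// addrC -[1]/(1%:P) size_XaddC.
have hv : size (2^-1 *: (1 - 'X) : {poly F}) = 2.
  by rewrite size_scale ?invr_eq0// -opprB size_polyN -[1]/(1%:P) size_XsubC.
rewrite /bernstein size_scale ?pnatr_eq0 -?lt0n ?bin_gt0//.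
have sX (u : {poly F}) (m : nat) : size u = 2 -> size (u ^+ m) = m.+1.
  move=> su; have u0 : u != 0 by rewrite -size_poly_eq0 su.
  by rewrite (polySpred (expf_neq0 m u0)) size_exp su mul1n.
by rewrite size_mul -?size_poly_eq0 ?sX// addnS addSn subnKC.
Qed.

Lemma root_bernstein (F : numFieldType) (n k : nat) (x : F) :
  (k <= n)%N -> root (bernstein F n k) x -> x ^+ 2 = 1.
Proof.
move=> kn; have p0 : (2 : F) != 0 by rewrite pnatr_eq0.
rewrite rootE /bernstein !(hornerZ, hornerM, horner_exp).
rewrite !(hornerD, hornerN, hornerX, hornerC).
rewrite !mulf_eq0 !expf_eq0 !mulf_eq0 !invr_eq0 (negPf p0) pnatr_eq0.
rewrite eqn0Ngt bin_gt0 kn /=.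
case/orP => /andP[_]; last by move/eqP/subr0_eq <-; rewrite expr1n.
by rewrite addrC addr_eq0 => /eqP->; rewrite sqrrN expr1n.
Qed.

(** Follows from ((w + 1/w)/2)^2 - 1 = ((w^2 - 1)/(2w))^2. *)
Lemma ebreve_sqr1 (F : numFieldType) (w : F) :
  w != 0 -> ebreve w ^+ 2 = 1 -> w ^+ 2 = 1.
Proof.
move=> w0 h; have p0 : (2 : F) != 0 by rewrite pnatr_eq0.
apply/subr0_eq/eqP; rewrite -sqrf_eq0.
have -> : (w ^+ 2 - 1) ^+ 2 = (2 * w) ^+ 2 * (ebreve w ^+ 2 - 1).
  by rewrite /ebreve; field; rewrite w0.
by rewrite h subrr mulr0.
Qed.

Lemma coprimep_DSx (R : realType) (q : R) (n k : nat) :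
  0 < q < 1 -> (k <= n)%N ->
  coprimep (Sx q (bernstein R[i] n k)) (Dx q (bernstein R[i] n k)).
Proof.
move=> q01 kn; set f := bernstein _ n k.
(* Over the algebraically closed [R[i]] it suffices to exclude a common root, which is then lifted
   to some z. *)
apply: Pdiv.ClosedField.root_coprimep => x; rewrite rootE => /eqP Sx0.
apply/eqP => Dx0; have [z z0 zx] := ebreve_surj x.
have p0 := qhalf_neq0 q01; set p := qhalf q in p0.
have HD := breve_subE f q01 z0; have HS := breve_addE f q01 z0.
rewrite zx Dx0 mul0r -/p in HD; rewrite zx Sx0 mulr0 -/p in HS.
(* The zero of Df makes the two lattice values equal, the zero of Sf makes them opposite; hence both
   vanish. *)
have fE : breve f (p * z) = breve f (p^-1 * z) by apply/subr0_eq.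
have f0 : breve f (p^-1 * z) = 0.
  move/eqP: HS; rewrite fE -mulr2n mulrn_eq0 /= => /eqP //.
have zV : (p^-1 * z) ^+ 2 = 1.
  apply: ebreve_sqr1; first by rewrite mulf_neq0 ?invr_eq0.
  by apply: (root_bernstein kn); apply/rootP; exact: f0.
have zp : (p * z) ^+ 2 = 1.
  apply: ebreve_sqr1; first by rewrite mulf_neq0.
  by apply: (root_bernstein kn); apply/rootP; rewrite -[LHS]/(breve f _) fE.
(* The squares of the two lattice points have quotient p^4 = q^2, which is below 1. *)
have : (p ^+ 2) ^+ 2 = 1.
  have <- : (p * z) ^+ 2 / (p^-1 * z) ^+ 2 = (p ^+ 2) ^+ 2.
    by field; rewrite p0.
  by rewrite zV zp divr1.
case/andP: q01 => q0 q1; rewrite /p /qhalf -!rmorphXn /= sqr_sqrtr ?ltW//.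
rewrite -[1]/(1%:C) => /complexI/eqP; rewrite lt_eqF// expr_lt1// ltW//.
Qed.

(** * Solvability of the q-ladder equation *)

Lemma q_ladder_sol (R : realType) (q : R) (n k : nat) :
  0 < q < 1 -> (n <= 2)%N -> (k <= n)%N ->
  exists sigma tau : {poly R[i]}, (sigma, tau) <> (0, 0) /\
    q_ladder q n k sigma tau.
Proof.
move=> q01 n2 kn; set f := bernstein R[i] n k.
have fn : size f = n.+1 := size_bernstein _ kn.
exists (Sx q f), (Dx q f); split.
  by case=> /eqP; rewrite -size_poly_eq0 size_Sx// fn.
split; last exact: mulrC.
  by rewrite size_Sx// fn.
by have [h _] := size_DSx q01 (eq_leq fn); exact: leq_trans h n2.
Qed.

Lemma q_ladder_trivial (R : realType) (q : R) (n k : nat)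
    (sigma tau : {poly R[i]}) :
  0 < q < 1 -> (3 <= n)%N -> (k <= n)%N ->
  q_ladder q n k sigma tau -> sigma = 0 /\ tau = 0.
Proof.
move=> q01 n3 kn [s3 t2 E]; set f := bernstein R[i] n k in E.
have Sn : size (Sx q f) = n.+1 by rewrite size_Sx// size_bernstein.
have s0 : sigma = 0.
  (* Gauss: [Sx q f] divides sigma times [Dx q f] and is coprime to the latter. Its size n + 1 >= 4
     exceeds that of sigma. *)
  have : Sx q f %| sigma.
    by rewrite -(Gauss_dvdpl _ (coprimep_DSx q01 kn)) E dvdp_mulIr.
  apply: contraTeq => /dvdp_leq h; apply/negP => /h.
  by rewrite Sn leqNgt ltnS (leq_trans s3).
split=> //; apply/eqP; move/esym/eqP: E; rewrite s0 mul0r mulf_eq0.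
by rewrite -[Sx q f == 0]size_poly_eq0 Sn orbF.
Qed.

(** * Convergence of polynomials as q tends to 1 from below *)

Lemma cvg_real_complex (R : realType) (T : Type) (G : set_system T)
    {FG : Filter G} (f : T -> R) (l : R) :
  f t @[t --> G] --> l ->
  ((f t)%:C : (R[i] : numFieldType)) @[t --> G] -->
    (l%:C : (R[i] : numFieldType)).
Proof.
(* A positive element of [R[i]] has zero imaginary part, so the tolerance is real. *)
move=> /cvgrPdist_lt fl; apply/cvgrPdist_lt => -[e e'].
rewrite ltcE /= => /andP[/eqP -> e0]; apply: filterS (fl e e0) => t.
by rewrite -rmorphB normc_def /= expr0n addr0 sqrtr_sqr ltcR.
Qed.

Lemma poly_cvg_cst (F : numFieldType) (T : Type) (G : set_system T)
    {FG : Filter G} (P : {poly F}) : poly_cvg G (fun=> P) P.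
Proof.
split; last by move=> i; exact: cvg_cst.
by exists (size P); apply: filterE.
Qed.

Lemma poly_cvgC (F : numFieldType) (T : Type) (G : set_system T)
    {FG : Filter G} (c : T -> F) (l : F) :
  c t @[t --> G] --> l -> poly_cvg G (fun t => (c t)%:P) l%:P.
Proof.
move=> cl; split.
  by exists 1%N; apply: filterE => t; exact: size_polyC_leq1.
case=> [|i]; under eq_cvg do rewrite coefC; rewrite coefC//=.
exact: cvg_cst.
Qed.

Lemma poly_cvgD (F : numFieldType) (T : Type) (G : set_system T)
    {FG : Filter G} (P Q : T -> {poly F}) (K L : {poly F}) :
  poly_cvg G P K -> poly_cvg G Q L -> poly_cvg G (fun t => P t + Q t) (K + L).
Proof.
move=> [[a Pa] PK] [[b Qb] QL]; split.
  exists (maxn a b); apply: filterS2 Pa Qb => t ta tb.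
  by rewrite (leq_trans (size_polyD _ _))// geq_max !leq_max ta tb orbT.
by move=> i; under eq_cvg do rewrite coefD; rewrite coefD; exact: cvgD.
Qed.

(** Each coefficient of a product is a convolution sum whose length depends only on the index, so
    the limit passes inside. *)
Lemma poly_cvgM (F : numFieldType) (T : Type) (G : set_system T)
    {FG : Filter G} (P Q : T -> {poly F}) (K L : {poly F}) :
  poly_cvg G P K -> poly_cvg G Q L -> poly_cvg G (fun t => P t * Q t) (K * L).
Proof.
move=> [[a Pa] PK] [[b Qb] QL]; split.
  exists (a + b)%N; apply: filterS2 Pa Qb => t ta tb.
  rewrite (leq_trans (size_polyMleq _ _))//.
  by rewrite (leq_trans (leq_pred _))// leq_add.
move=> i; under eq_cvg do rewrite coefM; rewrite coefM.
by apply: cvg_big => [|j _]; [exact: add_continuous|exact: cvgM].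
Qed.

(** Allows the product rules, available only for 0 < q < 1, to be used under the limit. *)
Lemma poly_cvg_near_eq (F : numFieldType) (T : Type) (G : set_system T)
    {FG : Filter G} (P Q : T -> {poly F}) (L : {poly F}) :
  (\forall t \near G, P t = Q t) -> poly_cvg G P L -> poly_cvg G Q L.
Proof.
move=> PQ [[a Pa] PL]; split.
  by exists a; apply: filterS2 PQ Pa => t ->.
move=> i; apply: cvg_trans (PL i); apply: near_eq_cvg.
by apply: filterS PQ => t ->.
Qed.

Lemma near1_left_itv (R : realType) : \forall q \near (1 : R)^'-, 0 < q < 1.
Proof.
by near=> q; apply/andP; split; near: q;
  [exact: nbhs_left_gt|exact: nbhs_left_lt].
Unshelve. all: by end_near. Qed.

Lemma cvg_qalpha (R : realType) :
  (qalpha q : (R[i] : numFieldType)) @[q --> (1 : R)^'-] -->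
    (1 : (R[i] : numFieldType)).
Proof.
have cs : (qhalf q : (R[i] : numFieldType)) @[q --> (1 : R)^'-] -->
    (1 : (R[i] : numFieldType)).
  apply: cvg_real_complex; rewrite -[X in _ --> X]sqrtr1.
  by apply: cvg_at_left_filter; exact: sqrt_continuous.
have -> : (1 : R[i]) = (1 + 1^-1) / 2 by rewrite invr1 divff ?pnatr_eq0.
apply: cvgM; last exact: cvg_cst.
apply: cvgD; first exact: cs.
by apply: (cvgV _ cs); exact: oner_neq0.
Qed.

Lemma poly_cvg_DSx (R : realType) (f : {poly R[i]}) :
  poly_cvg (1 : R)^'- (fun q : R => Dx q f) (deriv f) /\
  poly_cvg (1 : R)^'- (fun q : R => Sx q f) f.
Proof.
have near01 := near1_left_itv R.
elim/poly_ind: f => [|f c [IHD IHS]].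
  split; [rewrite deriv0|]; apply: poly_cvg_near_eq (poly_cvg_cst 0).
    by apply: filterS near01 => q q01; rewrite Dx0.
  by apply: filterS near01 => q q01; rewrite Sx0.
have Ca : poly_cvg (1 : R)^'- (fun q => (qalpha q)%:P) 1%:P.
  exact: poly_cvgC (@cvg_qalpha R).
have CX (P : {poly R[i]}) : poly_cvg (1 : R)^'- (fun=> P) P.
  exact: poly_cvg_cst.
split.
  (* The rule for D at alpha = 1 is the Leibniz rule. *)
  have -> : deriv (f * 'X + c%:P) = f + 1%:P * ('X * deriv f).
    by rewrite derivMXaddC mul1r mulrC.
  apply: poly_cvg_near_eq.
    by apply: filterS near01 => q q01; rewrite Dx_MXaddC.
  exact (poly_cvgD IHS (poly_cvgM Ca (poly_cvgM (CX 'X) IHD))).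
(* The limit is written in the shape of the rule for S at alpha = 1, where the term in Df drops
   out. *)
have fE : f * 'X + c%:P =
    (1 ^+ 2 - 1)%:P * (('X ^+ 2 - 1) * deriv f) + 1%:P * ('X * f) + c%:P.
  by rewrite expr1n subrr mul0r add0r mul1r mulrC.
rewrite [X in poly_cvg _ _ X]fE; apply: poly_cvg_near_eq.
  by apply: filterS near01 => q q01; rewrite Sx_MXaddC.
have Ca2 : (qalpha q ^+ 2 - 1 : (R[i] : numFieldType)) @[q --> (1 : R)^'-] -->
    (1 ^+ 2 - 1 : (R[i] : numFieldType)).
  exact (cvgB (cvgM (@cvg_qalpha R) (@cvg_qalpha R)) (cvg_cst _)).
exact (poly_cvgD (poly_cvgD (poly_cvgM (poly_cvgC Ca2)
  (poly_cvgM (CX ('X ^+ 2 - 1)) IHD)) (poly_cvgM Ca (poly_cvgM (CX 'X) IHS)))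
  (CX c%:P)).
Qed.

(** * Affine and classical ladders *)

(** Logarithmic derivative of u^k v^m, multiplied by uv to avoid division and negative exponents. *)
Lemma deriv_exp_mul (R : comNzRingType) (u v : {poly R}) (k m : nat) :
  u * v * deriv (u ^+ k * v ^+ m) =
    (k%:R * deriv u * v + m%:R * u * deriv v) * (u ^+ k * v ^+ m).
Proof.
have hX (w : {poly R}) (j : nat) : w * deriv (w ^+ j) = j%:R * deriv w * w ^+ j.
  rewrite deriv_exp; case: j => [|j]; first by rewrite mulr0n !(mulr0, mul0r).
  by rewrite /= -mulr_natl exprS; ring.
have -> : u * v * deriv (u ^+ k * v ^+ m) =
    u * deriv (u ^+ k) * v * v ^+ m + u * u ^+ k * (v * deriv (v ^+ m)).
  by rewrite derivM; ring.
by rewrite !hX; ring.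
Qed.

(** With u = (1 + x)/2 and v = (1 - x)/2, 1 - x^2 = 4uv, and the logarithmic derivative leaves the
    factor k(1 - x) - (n - k)(1 + x) = 2k - n - nx. *)
Lemma ladder_bernstein (F : numFieldType) (n k : nat) : (k <= n)%N ->
  ladder_sigma F * deriv (bernstein F n k) =
    ladder_tau F n k * bernstein F n k.
Proof.
move=> kn; have p0 : (2 : F) != 0 by rewrite pnatr_eq0.
pose u : {poly F} := 2^-1 *: (1 + 'X); pose v : {poly F} := 2^-1 *: (1 - 'X).
(* [ring] sees the constant polynomial 1/2 as an atom; this relation is applied by hand. *)
have h2 : 2 * (2^-1)%:P = 1 :> {poly F}.
  by rewrite -[2](rmorph_nat (@polyC F)) -polyCM divff.
have Du : deriv u = (2^-1)%:P.
  by rewrite derivZ derivD derivX -polyC1 derivC add0r -mul_polyC mulr1.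
have Dv : deriv v = - (2^-1)%:P.
  by rewrite derivZ derivB derivX -polyC1 derivC sub0r -mul_polyC mulrN mulr1.
have E : ladder_sigma F = 4 * (u * v).
  rewrite /ladder_sigma /u /v -!mul_polyC.
  transitivity ((2 * (2^-1)%:P) ^+ 2 * (1 - 'X ^+ 2) : {poly F}); last by ring.
  by rewrite h2 expr1n mul1r.
rewrite /bernstein -/u -/v derivZ -!scalerAr; congr (_ *: _).
rewrite E -mulrA deriv_exp_mul Du Dv (mulrA 4); congr (_ * _).
rewrite /ladder_tau /u /v -!mul_polyC polyCB polyCM !(rmorph_nat (@polyC F)).
(* Expresses n through the truncated difference n - k, which k <= n makes exact. *)
have nE : n%:R = (n - k)%:R + k%:R :> {poly F} by rewrite -natrD subnK.
rewrite nE.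
transitivity ((2 * (2^-1)%:P) ^+ 2 *
  (k%:R * (1 - 'X) - (n - k)%:R * (1 + 'X)) : {poly F}); first by ring.
by rewrite h2; ring.
Qed.

Lemma ladder_bernstein01 (F : fieldType) (n k : nat) : (k <= n)%N ->
  'X * (1 - 'X) * deriv (bernstein01 F n k) =
    (k%:R - n%:R * 'X) * bernstein01 F n k.
Proof.
move=> kn; rewrite /bernstein01 derivZ -!scalerAr; congr (_ *: _).
rewrite deriv_exp_mul derivB derivX -polyC1 derivC; congr (_ * _).
have nE : n%:R = (n - k)%:R + k%:R :> {poly F} by rewrite -natrD subnK.
by rewrite nE; ring.
Qed.

Lemma affine_ladder (R : realType) (n k : nat) (x : R) : (k <= n)%N ->
  affine_lhs n k x = affine_rhs n k x.
Proof.
move=> /(ladder_bernstein R) /(congr1 (horner^~ x)).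
rewrite /affine_lhs /affine_rhs -derivE !(hornerM, hornerD, hornerN, hornerZ).
by rewrite !(hornerX, hornerXn, hornerC).
Qed.

Lemma classical_ladder (R : realType) (n k : nat) (t : R) : (k <= n)%N ->
  classical_lhs n k t = classical_rhs n k t.
Proof.
move=> /(ladder_bernstein01 R) /(congr1 (horner^~ t)).
rewrite /classical_lhs /classical_rhs -derivE.
rewrite -polyC1 -!(rmorph_nat (@polyC R)).
by rewrite !(hornerM, hornerD, hornerN, hornerX, hornerC).
Qed.

Lemma bernstein_affine (F : numFieldType) (n k : nat) (x : F) :
  (bernstein F n k).[x] = (bernstein01 F n k).[(1 + x) / 2].
Proof.
have p0 : (2 : F) != 0 by rewrite pnatr_eq0.
rewrite !(hornerM, hornerD, hornerN, hornerZ, horner_exp, hornerX, hornerC).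
congr (_ * (_ ^+ _ * _ ^+ _)); first by rewrite mulrC.
by field.
Qed.

Theorem proposition4p4 (R : realType) :
  [/\
      (forall (q : R) (n k : nat), 0 < q < 1 -> (n <= 2)%N -> (k <= n)%N ->
        exists sigma tau : {poly R[i]},
          (sigma, tau) <> (0, 0) /\ q_ladder q n k sigma tau),
      (forall (q : R) (k : nat), 0 < q < 1 -> (k <= 3)%N ->
        forall sigma tau : {poly R[i]},
          q_ladder q 3 k sigma tau -> sigma = 0 /\ tau = 0),
      (forall f : {poly R[i]},
        poly_cvg (1 : R)^'- (fun q : R => Dx q f) (deriv f) /\
        poly_cvg (1 : R)^'- (fun q : R => Sx q f) f),
      (forall n k : nat, (k <= n)%N ->
        [/\ poly_cvg (1 : R)^'-
              (fun q : R => ladder_sigma R[i] * Dx q (bernstein R[i] n k))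
              (ladder_sigma R[i] * deriv (bernstein R[i] n k)),
            poly_cvg (1 : R)^'-
              (fun q : R => ladder_tau R[i] n k * Sx q (bernstein R[i] n k))
              (ladder_tau R[i] n k * bernstein R[i] n k),
            ladder_sigma R[i] * deriv (bernstein R[i] n k) =
              ladder_tau R[i] n k * bernstein R[i] n k &
            forall x : R, -1 <= x <= 1 -> affine_lhs n k x = affine_rhs n k x]) &
      (forall n k : nat, (k <= n)%N ->
        (forall t : R, 0 <= t <= 1 -> classical_lhs n k t = classical_rhs n k t) /\
        forall x t : R, t = (1 + x) / 2 ->
          [/\ (-1 <= x <= 1) <-> (0 <= t <= 1),
              (bernstein R n k).[x] = (bernstein01 R n k).[t],
              affine_lhs n k x = 2 * classical_lhs n k t,
              affine_rhs n k x = 2 * classical_rhs n k t &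
              affine_lhs n k x = affine_rhs n k x <->
                classical_lhs n k t = classical_rhs n k t])].
Proof.
split.
- by move=> q n k; exact: q_ladder_sol.
- by move=> q k q01 k3 sigma tau; exact: q_ladder_trivial.
- exact: poly_cvg_DSx.
- move=> n k kn; have [HD HS] := poly_cvg_DSx (bernstein R[i] n k); split.
  + exact (poly_cvgM (poly_cvg_cst _) HD).
  + exact (poly_cvgM (poly_cvg_cst _) HS).
  + exact: ladder_bernstein.
  + by move=> x _; exact: affine_ladder.
- move=> n k kn; split=> [t _|x t tE]; first exact: classical_ladder.
  have B : (bernstein R n k).[x] = (bernstein01 R n k).[t].
    by rewrite tE bernstein_affine.
  (* The factor 2 comes from 2k - n - nx = 2(k - nt). *)
  have rhsE : affine_rhs n k x = 2 * classical_rhs n k t.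
    by rewrite /affine_rhs /classical_rhs B tE; field.
  split=> //.
  + by rewrite tE; split=> /andP[h1 h2]; apply/andP; split; lra.
  (* The left sides are compared through the two ladders and [rhsE] instead of the chain rule. *)
  + by rewrite affine_ladder// classical_ladder.
  + by split=> _; [exact: classical_ladder|exact: affine_ladder].
Qed.
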